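(* For every integer $g$ there exists a constant $C(g)$, depending only on $g$, such that for every prime $p$ with $\gcd(g,p)=1$ we have $$N_g(2) \leq C(g)\, \frac{p}{\log p}.$$
   Context: For a prime $p$ and an integer $g$ with $\gcd(g,p)=1$, the function $f_g$ is defined on nonnegative integers $u$ by the conditions $f_g(u) \equiv g^u \pmod p$ and $0 \leq f_g(u) \leq p-1$ (so $f_g$ depends on $p$). For an initial value $u_0$ consider the sequence $u_n = f_g(u_{n-1})$, $n = 1,2,\ldots$. For a positive integer $k$, $N_g(k)$ (which depends on $p$ as well) denotes the number of $u_0 \in \{1,\ldots,p-1\}$ for which $u_k = u_0$. In particular, $N_g(2)$ is the number of $u \in \{1,\ldots,p-1\}$ with $f_g(f_g(u))=u$. Here $\log$ is the natural logarithm. *)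

(* Defs.v *)
From mathcomp Require Import all_boot all_order all_algebra.

Set Implicit Arguments.
Unset Strict Implicit.
Unset Printing Implicit Defensive.

Import GRing.Theory.
Local Open Scope ring_scope.

(* [f_g(u)]: for [p != 0] the remainder [%%] on [int] lies in [0, p - 1],
   so the absolute value is only a cast from [int] to [nat]. *)
Definition powmap (g : int) (p u : nat) : nat := `|(g ^+ u %% p%:Z)%Z|%N.

(* [N_g(k)], with [u_k] the [k]-th iterate of [f_g] at [u_0]. *)
Definition Ncyc (g : int) (p k : nat) : nat :=
  #|[set u0 : 'I_p | (0 < u0)%N && (iter k (powmap g p) u0 == u0)]|.

(* Main.v *)
(** If [u] and [u + 2k] both satisfy [f_g(f_g(u)) = u], then modulo [p] the
    element [u] is a root of one of [g^(2k)] polynomials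
    [X^(g^(2k)) - g^m (X + 2k)], so this happens for at most [g^(4k)] values of
    [u]. The other solutions have only long even gaps, hence are sparse:
    for every [K] there are at most [K g^(4K) + 2 (p / (2K) + 1)] solutions,
    and [K] is taken to be about [log p / (8 log |g|)]. For [|g| <= 1] the map
    [f_g] takes at most two values. *)

Require Import Defs.
From mathcomp Require Import all_boot all_order all_algebra.
From mathcomp Require Import all_field.
From mathcomp Require Import zify ring lra.
From mathcomp Require Import reals exp.

Import Order.TTheory GRing.Theory Num.Theory.
Local Open Scope ring_scope.

Lemma powmap_lt (g : int) (p u : nat) : (0 < p)%N -> (powmap g p u < p)%N.
Proof.
move=> p_gt0; rewrite /powmap.
have p_neq0 : p%:Z != 0 by lia.
have := modz_ge0 (g ^+ u) p_neq0; have := ltz_mod (g ^+ u) p_neq0; lia.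
Qed.

Lemma powmap_Fp (g : int) (p u : nat) : prime p ->
  (powmap g p u)%:R = g%:~R ^+ u :> 'F_p.
Proof.
move=> p_pr; have p_neq0 : p%:Z != 0 by have := prime_gt0 p_pr; lia.
rewrite /powmap [LHS]pmulrn gez0_abs ?modz_ge0 // -rmorphXn /=.
rewrite /modz rmorphB rmorphM /= -[p%:~R]/(p%:R) pchar_Fp_0 //.
by rewrite mulr0 subr0.
Qed.

Lemma Fp_nat_inj (p m n : nat) : prime p -> (m < p)%N -> (n < p)%N ->
  m%:R = n%:R :> 'F_p -> m = n.
Proof.
by move=> p_pr lt_m lt_n /(congr1 val); rewrite /= !val_Fp_nat // !modn_small.
Qed.

(** Since [d > 1], the linear term [c (X + a)] cannot cancel [X^d], so the polynomial has degree
    exactly [d] whatever [c] is. *)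
Lemma root_binomial_card (F : idomainType) (d : nat) (c a : F) (s : seq F) :
  (1 < d)%N -> uniq s -> all (fun x => x ^+ d == c * (x + a)) s ->
  (size s <= d)%N.
Proof.
move=> d_gt1 s_uniq s_root; pose P : {poly F} := 'X^d - c *: ('X + a%:P).
have sizeP : size P = d.+1.
  rewrite size_polyDl size_polyXn // size_polyN.
  by rewrite (leq_ltn_trans (size_scale_leq _ _)) // size_XaddC.
rewrite -ltnS -sizeP max_poly_roots //; first by rewrite -size_poly_gt0 sizeP.
apply: sub_all s_root => x /eqP x_root.
by rewrite /root !hornerE x_root subrr.
Qed.

Lemma card_bigcup_le (I T : finType) (B : I -> {set T}) (b : nat) :
  (forall i, #|B i| <= b)%N -> (#|\bigcup_i B i| <= #|I| * b)%N.
Proof.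
move=> leB; rewrite -sum_nat_const.
apply: (@leq_trans (\sum_(i : I) #|B i|)%N); last exact: leq_sum.
elim/big_rec2: _ => [|i n A _ IH]; first by rewrite cards0.
by rewrite (leq_trans (leq_card_setU _ _)) ?leq_add2l.
Qed.

(* Two elements of the same parity in the same block of length [2K] differ by
   an even number less than [2K]. *)
Lemma card_no_short_even_gap (n K : nat) (A : {set 'I_n}) : (0 < K)%N ->
  (forall (u w : 'I_n) (k : 'I_K),
     u \in A -> w \in A -> w <> (u + k.+1.*2)%N :> nat) ->
  (#|A| <= 2 * (n %/ K.*2).+1)%N.
Proof.
move=> K_gt0 gapA.
have blockP (u : 'I_n) : (u %/ K.*2 < (n %/ K.*2).+1)%N.
  by rewrite ltnS leq_div2r // ltnW.
pose f (u : 'I_n) := (odd u, Ordinal (blockP u)).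
have no_lt (u w : 'I_n) : u \in A -> w \in A -> f u = f w -> (u < w)%N -> False.
  move=> uA wA [par blk] lt_uw.
  have K2_gt0 : (0 < K.*2)%N by rewrite double_gt0.
  have gap : (w < u + K.*2)%N.
    have := divn_eq u K.*2; have := divn_eq w K.*2.
    have := ltn_pmod w K2_gt0; rewrite -blk; lia.
  (* The predecessor appears because index [k] encodes the gap [2(k + 1)], which excludes gap
     zero. *)
  have k_lt : ((w - u)./2.-1 < K)%N by lia.
  by apply: (gapA u w (Ordinal k_lt)) => //=; lia.
rewrite -card_bool -[X in (_ * X)%N]card_ord -card_prod.
apply: (@leq_card_in _ _ f) => u w uA wA fuw; apply/val_inj.
have [lt_uw|lt_wu|//] := ltngtP u w.
- by case: (no_lt u w uA wA fuw lt_uw).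
- by case: (no_lt w u wA uA (esym fuw) lt_wu).
Qed.

Definition cycle2 (g : int) (p : nat) : {set 'I_p} :=
  [set u : 'I_p | (0 < u)%N && (iter 2 (powmap g p) u == u)].

(* Writing [v = f_g(u)] and [v' = f_g(u + 2k)], one has [v' = g^(2k) v - m p]
   with [0 <= m < g^(2k)]; raising [g] to this power and using [g^p = g] gives
   the equation. Even shifts keep [g^(2k)] positive when [g] is negative. *)
Lemma cycle2_shift (g : int) (p k : nat) (u w : 'I_p) : prime p -> g != 0 ->
  u \in cycle2 g p -> w \in cycle2 g p -> w = (u + k.*2)%N :> nat ->
  let d := (`|g| ^ k.*2)%N in
  exists2 m : nat, (m < d)%N &
    u%:R ^+ d = g%:~R ^+ m * (u%:R + k.*2%:R) :> 'F_p.
Proof.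
move=> p_pr g_neq0 + + wu d; rewrite !inE /= => /andP[_ /eqP uE] /andP[_ /eqP wE].
have p_gt0 := prime_gt0 p_pr.
set gF : 'F_p := g%:~R.
set v := powmap g p u in uE; set v' := powmap g p w in wE.
have dE : d%:R = gF ^+ k.*2.
  rewrite /d /gF -rmorphXn /= pmulrn; congr (_%:~R).
  rewrite -natz natrX natz abszE -muln2 mulnC !exprM.
  by rewrite real_normK ?num_real.
have v'E : v' = ((d * v) %% p)%N.
  apply: (@Fp_nat_inj p); rewrite ?ltn_pmod ?powmap_lt //.
  rewrite /v' powmap_Fp // wu exprD -dE -powmap_Fp // -natrM mulnC.
  by apply/val_inj; rewrite /= !val_Fp_nat // modn_mod.
have d_gt0 : (0 < d)%N by rewrite expn_gt0 absz_gt0 g_neq0.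
exists ((d * v) %/ p)%N.
  by rewrite ltn_divLR // ltn_pmul2l // powmap_lt.
rewrite -natrD -wu -[in RHS]wE powmap_Fp // -[in LHS]uE powmap_Fp //.
rewrite -exprM mulnC {1}(divn_eq (d * v) p) -v'E exprD mulnC exprM.
by have := expf_card gF; rewrite card_Fp // => ->.
Qed.

Lemma card_root_binomial_ord (p d : nat) (c a : 'F_p) : prime p -> (1 < d)%N ->
  (#|[set u : 'I_p | ((u : nat)%:R ^+ d == c * ((u : nat)%:R + a))%R]| <= d)%N.
Proof.
move=> p_pr d_gt1; set S := finset _.
rewrite cardE -(size_map (fun u : 'I_p => (val u)%:R : 'F_p)).
apply: (@root_binomial_card _ _ c a) => //.
  rewrite map_inj_uniq ?enum_uniq // => u w uw.
  by apply/val_inj/(Fp_nat_inj _ _ _ p_pr (ltn_ord u) (ltn_ord w)).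
by apply/allP => _ /mapP[u + ->]; rewrite mem_enum inE.
Qed.

Lemma cycle2_bound (g : int) (p K : nat) : prime p -> (1 < `|g|)%N ->
  (0 < K)%N ->
  (#|cycle2 g p| <= K * (`|g| ^ K.*2 * `|g| ^ K.*2) + 2 * (p %/ K.*2).+1)%N.
Proof.
move=> p_pr g_gt1 K_gt0; set D := (`|g| ^ K.*2)%N.
pose d (k : 'I_K) := (`|g| ^ k.+1.*2)%N.
have d_le (k : 'I_K) : (d k <= D)%N by rewrite leq_exp2l // leq_double.
have d_gt1 (k : 'I_K) : (1 < d k)%N.
  by rewrite (leq_trans g_gt1) // -[X in (X <= _)%N]expn1 leq_exp2l.
(* The exponent [m < d k] is indexed by the larger ['I_D], uniformly in [k]; the extra indices only
   enlarge [E]. *)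
pose S (k : 'I_K) (m : 'I_D) := [set u : 'I_p |
  (u : nat)%:R ^+ d k == g%:~R ^+ m * ((u : nat)%:R + k.+1.*2%:R) :> 'F_p].
pose E := \bigcup_k \bigcup_m S k m.
have E_le : (#|E| <= K * (D * D))%N.
  have := card_bigcup_le _ _ (fun k => \bigcup_m S k m) (D * D).
  rewrite card_ord; apply=> k.
  have := card_bigcup_le _ _ (S k) D; rewrite card_ord; apply=> m.
  exact: leq_trans (card_root_binomial_ord _ _ _ _ p_pr (d_gt1 k)) (d_le k).
(* Solutions inside [E] are bounded by the root count; those outside [E] have no short even gap. *)
rewrite -(cardsID E) leq_add //.
  by rewrite (leq_trans _ E_le) // subset_leq_card // subsetIr.
apply: card_no_short_even_gap => // u w k.
rewrite !in_setD => /andP[/negP uE uA] /andP[_ wA] wu; apply: uE.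
have g_neq0 : g != 0 by rewrite -absz_gt0 ltnW.
have [m m_lt u_root] := cycle2_shift _ _ _ _ _ p_pr g_neq0 uA wA wu.
apply/bigcupP; exists k => //.
apply/bigcupP; exists (Ordinal (leq_trans m_lt (d_le k))) => //.
by rewrite inE; apply/eqP.
Qed.

(** Write [N] for the number of solutions and [a = |g|^K]. The base [|g|^8] gives [a^8 <= p], and
    with [K < a] the exceptional term satisfies [K^2 a^4 <= p]. Hence [N K <= p + (p + 2K) <= 4p],
    and [N <= p] supplies the fifth [p]. *)
Lemma cycle2_trunc_log (g : int) (p : nat) : prime p -> (1 < `|g|)%N ->
  (#|cycle2 g p| * (trunc_log (`|g| ^ 8) p).+1 <= 5 * p)%N.
Proof.
move=> p_pr g_gt1; set K := trunc_log _ _.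
have p_gt0 := prime_gt0 p_pr.
have g8_gt1 : (1 < `|g| ^ 8)%N by rewrite -(exp1n 8) ltn_exp2r.
have N_le : (#|cycle2 g p| <= p)%N.
  by rewrite -[X in (_ <= X)%N](card_ord p) max_card.
have [->|K_gt0] := posnP K; first lia.
have [pow_le _] := andP (trunc_log_bounds g8_gt1 p_gt0).
rewrite -/K -expnM in pow_le.
have K_lt := ltn_expl K g_gt1.
set a := (`|g| ^ K)%N in K_lt.
have aE : (`|g| ^ (8 * K) = a ^ 8)%N by rewrite -expnM mulnC.
have DE : (`|g| ^ K.*2 = a ^ 2)%N by rewrite -expnM muln2.
have := cycle2_bound _ _ _ p_pr g_gt1 K_gt0; rewrite DE => N_le2.
have div_le := leq_divM p K.*2.
rewrite aE in pow_le.
have KKa : (K * K * (a ^ 2 * a ^ 2) <= p)%N.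
  (* Split [a^8 = a^4 a^4] and use [K^2 <= a^2 <= a^4]. *)
  apply: leq_trans pow_le; rewrite -expnD (expnD a 4 4) leq_mul2r.
  apply/orP; right; apply: (@leq_trans (a ^ 2)); first by rewrite -mulnn leq_mul // ltnW.
  by rewrite leq_pexp2l //; lia.
have K_le : (K <= p)%N.
  apply: leq_trans pow_le; rewrite (leq_trans (ltnW K_lt)) //.
  by rewrite -[X in (X <= _)%N]expn1 leq_pexp2l //; lia.
have : (#|cycle2 g p| * K <= (K * (a ^ 2 * a ^ 2) + 2 * (p %/ K.*2).+1) * K)%N.
  by rewrite leq_mul2r N_le2 orbT.
move: (a ^ 2 * a ^ 2)%N KKa => b KKb.
have -> : ((K * b + 2 * (p %/ K.*2).+1) * K = K * K * b + (p %/ K.*2 * K.*2 + K.*2))%N.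
  by rewrite -!muln2; ring.
by rewrite mulnS; lia.
Qed.

(** Coprimality excludes [g = 0], so [g^2 = 1] and [g^n] depends only on the parity of [n]. A
    solution [u = f_g(f_g(u))] is thus determined by the parity of [f_g(u)]. *)
Lemma cycle2_unit (g : int) (p : nat) : prime p -> coprimez g p ->
  (`|g| <= 1)%N -> (#|cycle2 g p| <= 2)%N.
Proof.
move=> p_pr cop g_le1; have p_gt1 := prime_gt1 p_pr.
have g2 : g ^+ 2 = 1.
  suff: `|g|%N = 1%N by lia.
  case: (posnP `|g|%N) => [g0|]; last lia.
  by move: cop; rewrite /coprimez /gcdz g0 gcd0n; lia.
have powg n : g ^+ n = g ^+ odd n.
  by rewrite -{1}(odd_double_half n) -muln2 mulnC exprD exprM g2 expr1n mulr1.
rewrite -card_bool.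
apply: (@leq_card_in _ _ (fun u : 'I_p => odd (powmap g p u))) => u w.
rewrite !inE /= => /andP[_ /eqP uE] /andP[_ /eqP wE] par; apply/val_inj.
by rewrite /= -uE -wE /powmap powg par -powg.
Qed.

Theorem theorem3 (R : realType) (g : int) :
  exists C : R, forall p : nat, prime p -> coprimez g p%:Z ->
    (Ncyc g p 2)%:R <= C * (p%:R / ln (p%:R : R)).
Proof.
pose L : R := ln (`|g| ^ 8)%N%:R.
exists (if (`|g| <= 1)%N then 2 else 5 * L) => p p_pr cop.
have p_gt1 : 1 < p%:R :> R by rewrite ltr1n prime_gt1.
have lnp_gt0 : 0 < ln (p%:R : R) by rewrite ln_gt0.
rewrite mulrA ler_pdivlMr // -[Ncyc g p 2]/(#|cycle2 g p|).
have [g_le1|g_gt1] := leqP.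
  apply: ler_pM; rewrite ?ler0n ?(ltW lnp_gt0) //.
    by rewrite ler_nat cycle2_unit.
  (* Here [ln p <= p - 1] suffices. *)
  have := @le_ln1Dx R (p%:R - 1); rewrite [1 + _]addrC subrK => H.
  by apply: le_trans (H _) _; lra.
have := cycle2_trunc_log _ _ p_pr g_gt1.
set K := trunc_log _ _; rewrite -(ler_nat R) !natrM => N_le.
have g8_gt1 : (1 < `|g| ^ 8)%N by rewrite -(exp1n 8) ltn_exp2r.
have L_gt0 : 0 < L by rewrite ln_gt0 // ltr1n.
(* By maximality of [K], [p < |g|^(8(K + 1))]; take logarithms. *)
have lnp_le : ln (p%:R : R) <= K.+1%:R * L.
  rewrite mulr_natl -lnXn ?ltr0n ?(ltnW g8_gt1) // ler_ln ?posrE; last 2 first.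
  - by rewrite (lt_trans _ p_gt1).
  - by rewrite exprn_gt0 // ltr0n (ltnW g8_gt1).
  rewrite -natrX ler_nat ltnW //.
  by have [] := andP (trunc_log_bounds g8_gt1 (prime_gt0 p_pr)).
apply: le_trans (ler_wpM2l (ler0n _ _) lnp_le) _.
by rewrite mulrA [leRHS]mulrAC ler_wpM2r // ltW.
Qed.
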